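(* Let $G=\ast_{j\in J}A_j$ be a free product of groups, and let $N$ be a positive integer or $\infty$ such that $G$ has no nonidentity elements of order less than $N$. Suppose that $c_1\cdots c_k=u^n$ in $G$, where $k\ge 0$ and $n\ge 1$ are integers, each $c_i$ is a commutator of elements of $G$, and $u\in G$ is not conjugate to an element of any of the free factors $A_j$. Then $$2k\ge n-2\left[\frac nN\right]+1$$ (or, equivalently, $k\ge\left[\frac n2\right]-\left[\frac nN\right]+1$).
   Context: $[x]$ denotes the maximal integer not exceeding the real number $x$, with $[n/\infty]=0$. A commutator is an element of the form $[x,y]=x^{-1}y^{-1}xy$. *)

(* Defs.v *)
(* Mathematical Components; groups are the (possibly infinite) groupTypes of
   mathcomp.boot.monoid. *)
From HB Require Import structures.
From mathcomp Require Import all_boot all_order all_algebra.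

Set Implicit Arguments.
Unset Strict Implicit.
Unset Printing Implicit Defensive.

Local Open Scope group_scope.

(* G, with the maps iota j : A j -> G, is the free product (the coproduct in the
   category of groups) of the family A, stated by the universal property.
   The maps iota j are then injective, and the free factors are their images.
   Between groups, a multiplicative map automatically preserves 1 and inverses. *)
Definition is_free_product (J : Type) (A : J -> groupType) (G : groupType)
    (iota : forall j, {multiplicative A j -> G}) : Prop :=
  forall (H : groupType) (f : forall j, {multiplicative A j -> H}),
  exists2 phi : {multiplicative G -> H},
    forall j (a : A j), phi (iota j a) = f j a
  & forall psi : {multiplicative G -> H},
      (forall j (a : A j), psi (iota j a) = f j a) -> psi =1 phi.

Definition conjugate_to (G : groupType) (x y : G) : Prop :=
  exists g : G, x = y ^ g.

(* Here [~ x, y] = x^-1 * (y^-1 * (x * y)). *)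
Definition is_commutator (G : groupType) (c : G) : Prop :=
  exists x y : G, c = [~ x, y].

Definition has_order (G : groupType) (x : G) (m : nat) : Prop :=
  [/\ (0 < m)%N, x ^+ m = 1
    & forall d : nat, (0 < d < m)%N -> x ^+ d <> 1].

(* Elements of {0, 1, 2, ...} with infinity adjoined are encoded in option nat,
   None being infinity. *)
Definition ext_pos (N : option nat) : bool :=
  if N is Some N0 then (0 < N0)%N else true.

Definition lt_ext (m : nat) (N : option nat) : bool :=
  if N is Some N0 then (m < N0)%N else true.

(* The integer part of n / N, equal to 0 when N is infinite. *)
Definition floor_quot (n : nat) (N : option nat) : nat :=
  if N is Some N0 then (n %/ N0)%N else 0%N.

Definition no_order_below (G : groupType) (N : option nat) : Prop :=
  forall (x : G) (m : nat), x <> 1 -> has_order x m -> ~~ lt_ext m N.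

(* Main.v *)
Require Import Defs.
From HB Require Import structures.
From mathcomp Require Import all_boot all_order all_algebra.
From mathcomp Require Import all_fingroup boolp zify.

(* Write [u], up to conjugation, as a cyclically reduced word [w] of length [L >= 2].
   A diagram is the combinatorial form of a surface with one boundary circle,
   labelled by a word over the free factors, that maps to the free product:
   the letters are permuted by [sig] within their factors, cycles of [sig] whose
   labels multiply to 1 bound discs, and with [tau] the cyclic shift of the
   boundary word the cycles of [rho = tau sig^-1] are the complementary discs.  The
   number of discs minus the length of the word is the Euler characteristic.
   Words that admit a diagram of genus at most [k] are stable under the defining
   moves of the free product, in both directions, while exchanging two adjacent
   subwords costs one handle; hence a word representing a product of [k]
   commutators has such a diagram, and so has [w^n].

   It remains to bound the number of discs for [w^n].  Record each letter by its
   position modulo [L].  No cycle of [rho] is constant, and constant discs have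
   length at least [N].  Each nonconstant cycle has an ascent, and there are
   [n (L - 1)] ascents in all, since the step from [x] to [sig x] and the step of
   [rho] to [x] together have exactly one ascent unless [sig x] has position 0.
   If fewer than [n (L - 1)] nonconstant discs occur, counting descents
   bounds the constant ones.  Otherwise every nonconstant cycle has a single ascent, so it
   goes once around the circle and each of two opposite half circles contains the
   midpoint of one of its steps; as the two steps above have opposite midpoints,
   each half circle leaves room for at most [n] letters in constant discs, that is
   for [n / N] such discs. *)

Set Implicit Arguments.
Unset Strict Implicit.
Unset Printing Implicit Defensive.

Local Open Scope group_scope.

(** * Cycles of permutations *)

Section PermutationCycles.
Variable T : finType.
Implicit Types (s t : {perm T}) (p q : seq T) (D : {set T}).

(** Iterating [s] from [b] leads to [a], so some step on the way enters [P]. Applied to level sets,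
    this yields the ascents and descents of a cycle. *)
Lemma porbit_cross s (P : pred T) a b :
  a \in porbit s b -> ~~ P b -> P a ->
  exists2 x, x \in porbit s b & ~~ P x && P (s x).
Proof.
move=> /porbitP[i ->]; elim: i => [|i IHi] Pb; first by rewrite perm1 (negPf Pb).
have [Pi _|nPi] := boolP (P ((s ^+ i) b)); first exact: IHi.
by rewrite expgSr permM => Psi; exists ((s ^+ i) b); rewrite ?mem_porbit ?nPi.
Qed.

Lemma porbit_mem_perm s x y : (s y \in porbit s x) = (y \in porbit s x).
Proof. by rewrite -!eq_porbit_mem (_ : s y = (s ^+ 1) y) ?porbit_perm. Qed.

Lemma eq_in_porbits s t D :
  D \in porbits s -> {in D, t =1 s} -> D \in porbits t.
Proof.
case/imsetP=> x _ -> eq_ts.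
have eqX i : (t ^+ i) x = (s ^+ i) x.
  elim: i => [|i IHi]; first by rewrite !perm1.
  by rewrite !expgSr !permM IHi eq_ts ?mem_porbit.
apply/imsetP; exists x => //; apply/setP=> y.
by apply/porbitP/porbitP => -[i ->]; exists i; rewrite eqX.
Qed.

Lemma sub_porbit s D x : x \in D -> (forall y, y \in D -> s y \in D) ->
  porbit s x \subset D.
Proof.
move=> Dx sD; apply/subsetP=> y /porbitP[i ->].
by elim: i => [|i IHi]; rewrite ?perm1 // expgSr permM sD.
Qed.

Lemma porbits_eq s D1 D2 x : D1 \in porbits s -> D2 \in porbits s ->
  x \in D1 -> x \in D2 -> D1 = D2.
Proof.
case/imsetP=> y _ -> /imsetP[z _ ->].
by rewrite -!eq_porbit_mem => /eqP<- /eqP<-.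
Qed.

Lemma mem_porbits s D x : D \in porbits s -> x \in D -> D = porbit s x.
Proof.
move=> sD xD; apply: porbits_eq sD _ xD (porbit_id s x).
by apply/imsetP; exists x.
Qed.

Lemma porbits_perm s D x : D \in porbits s -> (s x \in D) = (x \in D).
Proof. by case/imsetP=> y _ ->; rewrite porbit_mem_perm. Qed.

(** Distinct cycles are disjoint, hence so are their traces on [c]. Every count of discs below rests
    on this. *)
Lemma leq_sum_porbits s (F : {set {set T}}) (c : {set T}) :
  F \subset porbits s -> (\sum_(D in F) #|D :&: c| <= #|c|)%N.
Proof.
move=> sF; have tF : trivIset F.
  apply/trivIsetP=> D1 D2 F1 F2; apply: contraR => /pred0Pn[x /andP[/= x1 x2]].
  by apply/eqP; apply: porbits_eq x1 x2; apply: (subsetP sF).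
have -> : (\sum_(D in F) #|D :&: c| = \sum_(x in cover F | x \in c) 1)%N.
  rewrite (big_trivIset_cond F) //; apply: eq_bigr => D _.
  by rewrite sum1dep_card; apply: eq_card => x; rewrite !inE.
by rewrite sum1dep_card; apply/subset_leq_card/subsetP=> x; rewrite inE => /andP[].
Qed.

Lemma card_porbits_tpermM s x y :
  (#|porbits s| <= #|porbits (tperm x y * s)|.+1)%N.
Proof. have [->|ne] := eqVneq x y; first by rewrite tperm1 mul1g.
by have /= := porbits_mul_tperm s x y; rewrite ne; case: (x \notin _) => /=; lia. Qed.

Lemma porbitsMtperm s x y : 
  (#|porbits (s * tperm x y)| + (x \notin porbit s y).*2 =
   #|porbits s| + (x != y))%N.
Proof.
rewrite -porbitsV invMg tpermV -(porbitsV s) -(porbitV s).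
exact: porbits_mul_tperm.
Qed.

Lemma card_porbitsMtperm s x y :
  (#|porbits s| <= #|porbits (s * tperm x y)|.+1)%N.
Proof. have [->|ne] := eqVneq x y; first by rewrite tperm1 mulg1.
by have /= := porbitsMtperm s x y; rewrite ne; case: (x \notin _) => /=; lia. Qed.

(** Conjugation by [s] carries a transposition from the middle of a product to its front, where its
    effect on the number of cycles is known. *)
Lemma tperm_mulg s t x y :
  s * tperm x y * t = tperm (s^-1 x) (s^-1 y) * (s * t).
Proof.
rewrite mulgA; congr (_ * t).
have {1}-> : x = s (s^-1 x) by rewrite permKV.
have {1}-> : y = s (s^-1 y) by rewrite permKV.
by rewrite -tpermJ conjgE !mulgA mulgV mul1g.
Qed.

Lemma card_porbits_mid s t x y :
  (#|porbits (s * t)| <= #|porbits (s * tperm x y * t)|.+1)%N.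
Proof. by rewrite tperm_mulg card_porbits_tpermM. Qed.

Lemma cyc_inj p : injective (next (undup p)).
Proof. exact: can_inj (prev_next (undup_uniq p)). Qed.

(** Removing duplicates first makes this a permutation for every list, with the points outside the
    list fixed. *)
Definition cyc p : {perm T} := perm (@cyc_inj p).

Lemma cycE p : uniq p -> cyc p =1 next p.
Proof. by move=> Up x; rewrite permE undup_id. Qed.

Lemma cyc_rot n p : uniq p -> cyc (rot n p) = cyc p.
Proof.
by move=> Up; apply/permP=> x; rewrite !cycE ?rot_uniq ?next_rot.
Qed.

Lemma cyc_out p x : x \notin p -> cyc p x = x.
Proof.
rewrite permE -mem_undup; case: (undup p) => [|a q] // xp.
by rewrite next_nth (negPf xp).
Qed.

(** The two short cycles close up at [a] and [b]; the transposition, applied last, redirects each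
    closing step to the head of the other list. *)
Lemma cyc_cat a p b q : uniq (a :: p ++ b :: q) ->
  cyc (a :: p ++ b :: q) = cyc (a :: p) * cyc (b :: q) * tperm a b.
Proof.
move=> U; have := U; rewrite -cat_cons cat_uniq => /and3P[Up /hasPn dis Uq].
have nxt x : next (a :: p ++ b :: q) x =
    if x \in (a :: p) ++ b :: q then nth a (p ++ b :: q) (index x ((a :: p) ++ b :: q)) else x.
  exact: next_nth.
apply/permP=> x; rewrite !permM cycE // nxt mem_cat index_cat.
have aq : a \notin b :: q by apply/negP=> /dis/=; rewrite mem_head.
have bp : b \notin a :: p by apply: dis; rewrite mem_head.
have [xp|xp] := boolP (x \in a :: p); rewrite ?orTb ?orFb.
  rewrite (cycE Up) next_nth xp.
  have := xp; rewrite -index_mem [size _]/= ltnS leq_eqVlt => /orP[/eqP->|lt].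
    by rewrite nth_cat ltnn subnn (nth_default a (leqnn (size p))) cyc_out ?tpermL.
  rewrite nth_cat lt; have yp := mem_nth a lt.
  have yq : nth a p (index x (a :: p)) \notin b :: q.
    by apply/negP=> /dis/=; rewrite inE yp orbT.
  rewrite cyc_out // tpermD //; first by apply: contraTneq Up => ->; rewrite /= yp.
  by apply: contraNneq yq => <-; rewrite mem_head.
rewrite [cyc (a :: p) x]cyc_out //.
have [xq|xq] := boolP (x \in b :: q); last first.
  rewrite cyc_out // tpermD //; first by apply: contraNneq xp => <-; rewrite mem_head.
  by apply: contraNneq xq => <-; rewrite mem_head.
rewrite [size _]/= (cycE Uq) next_nth xq nth_cat ifF; last by lia.
rewrite (_ : _ - _ = (index x (b :: q)).+1)%N; last by lia.
have := xq; rewrite -index_mem; move: (index x _) => i /=.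
rewrite ltnS leq_eqVlt => /orP[/eqP->|lt]; first by rewrite !nth_default // tpermR.
have yq := mem_nth b lt; rewrite (set_nth_default b) // tpermD //.
  by apply: contraNneq aq => ->; rewrite inE yq orbT.
by apply: contraTneq Uq => ->; rewrite /= yq.
Qed.

Lemma cyc_cons a b q : uniq (a :: b :: q) ->
  cyc (a :: b :: q) = cyc (b :: q) * tperm a b.
Proof.
move=> U; rewrite (@cyc_cat a [::]) //.
suff -> : cyc [:: a] = 1 by rewrite mul1g.
by apply/permP=> x; rewrite perm1 cycE //= /next /=; case: eqP.
Qed.

(** Exchanging two adjacent blocks costs two transpositions. Both sides split by [cyc_cat] into the
    same three disjoint cycles, up to order. *)
Lemma cyc_swap a p b q c r : uniq (a :: p ++ b :: q ++ c :: r) ->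
  cyc (b :: q ++ a :: p ++ c :: r) =
  cyc (a :: p ++ b :: q ++ c :: r) * tperm a c * tperm b c.
Proof.
move=> U; have [Ub Ua] : uniq (b :: q ++ c :: r) /\ uniq (a :: p ++ c :: r).
  move: U; rewrite -!cat_cons !cat_uniq !has_cat !negb_or.
  by case/and3P=> -> /andP[_ ->] /and3P[-> -> ->].
have U' : uniq (b :: q ++ a :: p ++ c :: r).
  by move: U; rewrite -!cat_cons !(uniq_catCA (b :: q)).
have neq : [/\ a != b, a != c & b != c].
  move: U; rewrite !(cons_uniq, mem_cat, inE, cat_uniq) !negb_or.
  by do !(case/andP || move=> ?); split.
case: neq => ab ac bc.
rewrite !cyc_cat // !mulgA.
have comm : cyc (a :: p) * cyc (b :: q) = cyc (b :: q) * cyc (a :: p).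
  have onc p' : perm_on [set x in p'] (cyc p').
    by apply/subsetP=> x; rewrite !inE; apply: contraR => /cyc_out->.
  apply: perm_onC (onc _) (onc _) _; apply/pred0P=> x /=; rewrite !in_set.
  apply: contraTF U => /andP[xp xq]; rewrite -cat_cons cat_uniq negb_and orbC negb_and.
  apply/orP; left; apply/orP; left; rewrite negbK; apply/hasP; exists x => //.
  by rewrite -cat_cons mem_cat xq.
rewrite -comm -!mulgA; do 3!congr (_ * _).
(* What remains is an identity between transpositions of [a], [b], [c], checked pointwise. *)
apply/permP=> x; rewrite !permM.
have [ba ca cb] : [/\ b != a, c != a & c != b] by rewrite ![_ == a]eq_sym [c == b]eq_sym.
have tD (u v w : T) : w != u -> w != v -> tperm u v w = w.
  by move=> wu wv; rewrite tpermD 1?eq_sym.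
have [->|xa] := eqVneq x a.
  by rewrite (tD b c a) // !tpermL (tD b a c) // (tD a c b) // tpermL.
have [->|xb] := eqVneq x b.
  by rewrite (tD a c b) // !tpermL (tD a b c) // tpermR tD.
have [->|xc] := eqVneq x c; last by rewrite (tD a c x) // !(tD _ _ x).
by rewrite !tpermR tpermL tpermR.
Qed.
End PermutationCycles.

(** * Diagrams and their moves *)

Section Diagrams.
Variables (J : Type) (A : J -> groupType) (G : groupType).
Variable iota : forall j : J, {multiplicative A j -> G}.

Definition letter := {j : J & A j}.
Implicit Types (l : letter) (u v w : seq letter).

Definition ev l : G := iota (tag l) (tagged l).

Variable j0 : J.
Definition dummy : letter := Tagged A (1 : A j0).

Lemma iota1 j : iota j 1 = 1.
Proof. by apply: (mulgI (iota j 1)); rewrite -gmulfM !mulg1. Qed.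

Section OnFinite.
Variable T : finType.
Implicit Types (lab : T -> letter) (s : seq T) (sig : {perm T}) (F : {set {set T}}).

(* A function [h] with these increments exists on a cycle exactly when the product
   of the labels around it is 1; stated this way, no base point is needed. *)
Definition trivial_cycle lab sig (D : {set T}) :=
  exists h : T -> G, forall x, x \in D -> h (sig x) = h x * ev (lab x).

(* The points outside [s] are spare: each is a disc for [sig] and for [rho], which
   accounts for the [2 * #|T|] in the Euler characteristic inequality. *)
Definition diagram k lab s sig F : Prop :=
  [/\ uniq s,
      forall x, x \notin s -> sig x = x /\ lab x = dummy,
      forall x, tag (lab (sig x)) = tag (lab x),
      F \subset porbits sig /\ {in F, forall D, trivial_cycle lab sig D}
    & (2 * #|T| + 1 <= #|F| + #|porbits (cyc s * sig^-1)| + size s + 2 * k)%N].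

Definition update lab p l x := if x == p then l else lab x.

Lemma trivial_cycle_in lab lab' sig sig' (D : {set T}) :
  {in D, sig =1 sig'} -> {in D, forall x, ev (lab x) = ev (lab' x)} ->
  trivial_cycle lab sig D -> trivial_cycle lab' sig' D.
Proof.
move=> eqs eql [h hP]; exists h => x xD.
by rewrite -eqs // -eql // hP.
Qed.

Lemma diagram_rot k lab s sig F i :
  diagram k lab s sig F -> diagram k lab (rot i s) sig F.
Proof.
case=> U out tg FP le; split=> //; rewrite ?rot_uniq ?cyc_rot ?size_rot //.
by move=> x; rewrite mem_rot; apply: out.
Qed.

Lemma map_update lab p l s : p \notin s -> map (update lab p l) s = map lab s.
Proof.
move=> ps; apply/eq_in_map=> x xs; rewrite /update ifN //.
by apply: contraNneq ps => <-.
Qed.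

(** A spare point is already fixed by [sig]. The length grows by one, while [rho] changes by one
    transposition and so loses at most one cycle. *)
Lemma diagram_insert k lab s sig F p j : s != [::] -> p \notin s ->
  diagram k lab s sig F ->
  diagram k (update lab p (Tagged A (1 : A j))) (p :: s) sig F.
Proof.
case: s => // b q _ ps [U out tg [sF FP] le].
have [sp lp] := out _ ps; split=> //=.
- by rewrite ps.
- move=> x; rewrite inE negb_or => /andP[xp /out[-> lx]].
  by rewrite /update (negPf xp).
- by move=> x; rewrite /update -[X in _ x == X]sp (inj_eq perm_inj); case: eqP.
- split=> // D /FP; apply: trivial_cycle_in => // x _; rewrite /update.
  by case: eqP => // ->; rewrite lp /ev /= !iota1.
have Ups : uniq (p :: b :: q) by rewrite cons_uniq ps.
have := card_porbits_mid (cyc (b :: q)) sig^-1 p b.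
by rewrite cyc_cons //; move: le => /=; clear; lia.
Qed.

(** Without [p] in the boundary word, [rho] fixes [p]; the transposition of [cyc_cons] joined this
    fixed point to another cycle. Deletion thus gains one cycle of [rho], making up for the lost
    letter. *)
Lemma diagram_delete_fix k lab s sig F p : s != [::] -> sig p = p ->
  ev (lab p) = 1 -> 
  diagram k lab (p :: s) sig F -> diagram k (update lab p dummy) s sig F.
Proof.
case: s => // b q _ sp lp [U out tg [sF FP] le].
have [pq Uq] : p \notin b :: q /\ uniq (b :: q) by move: U; rewrite cons_uniq => /andP.
split=> //.
- move=> x xq; rewrite /update; case: eqVneq => [->|xp]; first by rewrite sp.
  by apply: out; rewrite inE negb_or xp.
- by move=> x; rewrite /update -[X in _ x == X]sp (inj_eq perm_inj); case: eqP.
- split=> // D /FP; apply: trivial_cycle_in => // x _; rewrite /update.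
  by case: eqP => // ->; rewrite lp /ev /= !iota1.
move: le; rewrite cyc_cons // tperm_mulg.
set t := cyc _; set z := t^-1 b; set rho := t * sig^-1.
have tp : t p = p by apply: cyc_out.
have -> : t^-1 p = p by rewrite -{1}tp permK.
have pz : p != z.
  apply: contraNneq pq => /(congr1 t); rewrite tp permKV => ->; exact: mem_head.
have rp : p \notin porbit rho z.
  rewrite porbit_sym.
  have /subsetP sub : porbit rho p \subset [set p].
    apply: sub_porbit; rewrite ?inE // => y; rewrite !inE => /eqP->.
    by rewrite permM tp -{1}sp permK.
  by apply: contra pz => /sub; rewrite inE eq_sym.
have /= := porbits_mul_tperm rho p z; rewrite rp pz.
by move=> /=; clear; lia.
Qed.

(** Splice [p] out of its [sig]-cycle. As its label is trivial, [p] alone bounds a disc and the rest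
    of a disc is still a disc, so at least one disc is gained against at most one lost cycle of
    [rho]. *)
Lemma diagram_isolate k lab s sig F p : p \in s -> ev (lab p) = 1 ->
  diagram k lab s sig F ->
  exists sig' F', diagram k lab s sig' F' /\ sig' p = p.
Proof.
move=> ps lp dg; have [sp|sp] := eqVneq (sig p) p; first by exists sig, F.
have [U out tg [/subsetP sF FP] le] := dg.
pose r := sig^-1 p; pose sig' : {perm T} := tperm p r * sig.
have sr : sig r = p by rewrite permKV.
have rp : r != p by apply: contraNneq sp => E; rewrite -{1}E sr.
have sig'p : sig' p = p by rewrite permM tpermL.
have sig'r : sig' r = sig p by rewrite permM tpermR.
have sig'D x : x != p -> x != r -> sig' x = sig x.
  by move=> xp xr; rewrite permM tpermD 1?eq_sym.
have rs : r \in s by apply: contraT => /out[]; rewrite sr => /eqP; rewrite eq_sym (negPf rp).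
pose C := porbit sig p; pose F0 := [set D in F | p \notin D].
have FC D : D \in F -> p \in D -> D = C.
  by move=> /sF DF pD; apply: mem_porbits.
have C0 D : D \in F0 -> (D \in F) /\ {in D, sig' =1 sig}.
  rewrite inE => /andP[DF pD]; split=> // x xD.
  apply: sig'D; first by apply: contraNneq pD => <-.
  apply: contraNneq pD => xr; rewrite -sr porbits_perm -?xr //; exact: sF.
have sF0 D : D \in F0 -> D \in porbits sig'.
  by case/C0 => DF; apply: eq_in_porbits; apply: sF.
have g0 : {in F0, forall D, trivial_cycle lab sig' D}.
  move=> D /C0[DF eqD]; apply: trivial_cycle_in (FP _ DF) => // x xD.
  by rewrite eqD.
have p1 : porbit sig' p = [set p].
  apply/eqP; rewrite eqEsubset sub1set porbit_id andbT.
  by apply: sub_porbit; rewrite ?inE // => y; rewrite !inE => /eqP->; rewrite sig'p.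
have tg' x : tag (lab (sig' x)) = tag (lab x).
  have [->|xp] := eqVneq x p; first by rewrite sig'p.
  have [->|xr] := eqVneq x r; last by rewrite sig'D.
  by rewrite sig'r tg -[in LHS]sr tg.
have out' x : x \notin s -> sig' x = x /\ lab x = dummy.
  move=> xs; rewrite sig'D; first exact: out.
    by apply: contraNneq xs => ->.
  by apply: contraNneq xs => ->.
have rho : (#|porbits (cyc s * sig^-1)| <= #|porbits (cyc s * sig'^-1)|.+1)%N.
  by rewrite invMg tpermV mulgA; apply: card_porbitsMtperm.
have g1 : trivial_cycle lab sig' [set p].
  by exists (fun=> 1) => x; rewrite inE => /eqP->; rewrite lp mulg1.
have p0 : [set p] \notin F0 by rewrite !inE eqxx andbF.
have cF : (#|F| <= (C \in F) + #|F0|)%N.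
  rewrite (cardsD1 C F) leq_add2l; apply/subset_leq_card/subsetP=> D.
  rewrite !inE => /andP[DC DF]; rewrite DF; apply: contra DC => /FC-> //.
(* If the old cycle was no disc, the singleton is the gain; otherwise the old disc is replaced by
   the singleton and the remainder [E]. *)
have [CF|CF] := boolP (C \in F); last first.
  exists sig', ([set p] |: F0); split=> //; split=> //.
    split; first by apply/subsetP=> D /setU1P[->|/sF0//]; rewrite -p1 imset_f.
    by move=> D /setU1P[->|/g0].
  by move: cF le rho; rewrite cardsU1 p0 (negPf CF) /=; clear; lia.
pose E := porbit sig' (sig p).
have subE : E \subset C :\ p.
  apply: sub_porbit => [|y]; first by rewrite !inE sp porbit_mem_perm porbit_id.
  rewrite !inE => /andP[yp yC].
  rewrite -{1}sig'p (inj_eq perm_inj) yp /=.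
  have [->|yr] := eqVneq y r; first by rewrite sig'r porbit_mem_perm porbit_id.
  by rewrite sig'D // porbit_mem_perm.
have pE : p \notin E.
  by apply/negP=> /(subsetP subE); rewrite !inE eqxx.
have gE : trivial_cycle lab sig' E.
  have [h hP] := FP _ CF; exists h => x /(subsetP subE); rewrite !inE => /andP[xp xC].
  have [xr|xr] := eqVneq x r; last by rewrite sig'D // hP.
  by rewrite xr sig'r hP ?porbit_id // lp mulg1 -{1}sr hP // -xr.
have E0 : E \notin F0.
  apply/negP=> EF0; have [EF _] := C0 _ EF0.
  case/negP: pE; rewrite -(porbits_perm p (sF _ EF)); exact: porbit_id.
have Ep : [set p] != E.
  by apply: contraNneq pE => <-; rewrite inE.
exists sig', ([set p] |: (E |: F0)); split=> //; split=> //.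
  split.
    apply/subsetP=> D /setU1P[->|/setU1P[->|/sF0//]]; first by rewrite -p1 imset_f.
    by rewrite imset_f.
  by move=> D /setU1P[->|/setU1P[->|/g0]].
have pEF : [set p] \notin E |: F0 by rewrite in_setU1 negb_or Ep.
by move: cF le rho; rewrite cardsU1 pEF cardsU1 E0 CF /=; clear; lia.
Qed.

(** With [r] the [sig]-preimage of [q], [rho] maps [p] to [r]; redirecting [p] to [q] splits their
    common [rho]-cycle and gains one. This pays for the single disc that may be lost. *)
Lemma diagram_adjacent k lab p q s sig F : tag (lab p) = tag (lab q) ->
  diagram k lab (p :: q :: s) sig F ->
  exists sig' F', diagram k lab (p :: q :: s) sig' F' /\ sig' p = q.
Proof.
move=> tpq dg; have [sp|sp] := eqVneq (sig p) q; first by exists sig, F.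
have [U out tg [/subsetP sF FP] le] := dg.
have pq : p != q by move: U; rewrite /= inE negb_or => /andP[/andP[]].
pose r := sig^-1 q; pose sig' : {perm T} := tperm p r * sig.
have sr : sig r = q by rewrite permKV.
have rp : r != p by apply: contraNneq sp => E; rewrite -E sr.
have sig'p : sig' p = q by rewrite permM tpermL.
have sig'r : sig' r = sig p by rewrite permM tpermR.
have sig'D x : x != p -> x != r -> sig' x = sig x.
  by move=> xp xr; rewrite permM tpermD 1?eq_sym.
have rs : r \in p :: q :: s.
  apply: contraT => rs; have [] := out _ rs; rewrite sr => qr.
  by case/negP: rs; rewrite -qr !inE eqxx orbT.
pose C1 := porbit sig p; pose C2 := porbit sig q.
pose F0 := [set D in F | (p \notin D) && (q \notin D)].
have F1 D : D \in F -> p \in D -> D = C1.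
  by move=> /sF DF pD; apply: mem_porbits.
have F2 D : D \in F -> q \in D -> D = C2.
  by move=> /sF DF pD; apply: mem_porbits.
have C0 D : D \in F0 -> (D \in F) /\ {in D, sig' =1 sig}.
  rewrite inE => /and3P[DF pD qD]; split=> // x xD.
  apply: sig'D; first by apply: contraNneq pD => <-.
  apply: contraNneq qD => xr; rewrite -sr porbits_perm -?xr //; exact: sF.
have sF0 D : D \in F0 -> D \in porbits sig'.
  by case/C0 => DF; apply: eq_in_porbits; apply: sF.
have g0 : {in F0, forall D, trivial_cycle lab sig' D}.
  move=> D /C0[DF eqD]; apply: trivial_cycle_in (FP _ DF) => // x xD.
  by rewrite eqD.
have tg' x : tag (lab (sig' x)) = tag (lab x).
  have [->|xp] := eqVneq x p; first by rewrite sig'p.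
  have [->|xr] := eqVneq x r; last by rewrite sig'D.
  by rewrite sig'r tg tpq -sr tg.
have out' x : x \notin p :: q :: s -> sig' x = x /\ lab x = dummy.
  move=> xs; rewrite sig'D; first exact: out.
    by apply: contraNneq xs => ->; rewrite inE eqxx.
  by apply: contraNneq xs => ->.
have rho : #|porbits (cyc (p :: q :: s) * sig'^-1)| = #|porbits (cyc (p :: q :: s) * sig^-1)|.+1.
  rewrite invMg tpermV mulgA; set z := _ * sig^-1.
  have zp : z p = r by rewrite permM cycE //= /next /= eqxx.
  have := porbitsMtperm z p r; rewrite [p == r]eq_sym rp.
  by rewrite porbit_sym -zp porbit_mem_perm porbit_id [(_).*2]/= addn0 addn1.
have sub0 D : D \in F -> [|| D \in F0, D == C1 | D == C2].
  move=> DF; rewrite inE DF /=.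
  have [/F1->|_] := boolP (p \in D); rewrite ?eqxx ?orbT //.
  by have [/F2->|_] := boolP (q \in D); rewrite ?eqxx ?orbT.
(* Unless the cycles of [p] and [q] are two different discs, discarding both costs at most one disc.
   Two different discs merge into one disc [E]. *)
have [/and3P[CF1 CF2 C12]|nC] := boolP [&& C1 \in F, C2 \in F & C1 != C2]; last first.
  exists sig', F0; split=> //; split=> //; first by split=> //; apply/subsetP.
  suff [C sC] : exists C, F \subset C |: F0.
    move: le rho (subset_leq_card sC); rewrite cardsU1; case: (_ \notin _) => /=; clear; lia.
  have [CF1|CF1] := boolP (C1 \in F); last first.
    exists C2; apply/subsetP=> D DF; rewrite !inE; case/or3P: (sub0 _ DF) => [|/eqP E|->] //.
      by rewrite inE => ->; rewrite orbT.
    by rewrite -E DF in CF1.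
  exists C1; apply/subsetP=> D DF; rewrite !inE; case/or3P: (sub0 _ DF) => [|->|/eqP E] //.
    by rewrite inE => ->; rewrite orbT.
  by move: nC; rewrite CF1 -E DF /= negbK => /eqP->; rewrite eqxx.
have [h1 hP1] := FP _ CF1; have [h2 hP2] := FP _ CF2.
have dis x : x \in C1 -> x \in C2 -> False.
  move=> x1 x2; case/negP: C12; apply/eqP; exact: porbits_eq (sF _ CF1) (sF _ CF2) x1 x2.
pose E := porbit sig' p.
have p1 : p \in C1 by apply: porbit_id.
have q2 : q \in C2 by apply: porbit_id.
have r2 : r \in C2 by rewrite -(porbits_perm r (sF _ CF2)) sr.
have subE : E \subset C1 :|: C2.
  apply: sub_porbit => [|y]; first by rewrite inE p1.
  have [->|yp] := eqVneq y p; first by rewrite sig'p => _; apply/setUP; right.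
  have [->|yr] := eqVneq y r; first by rewrite sig'r !in_setU (porbits_perm p (sF _ CF1)) p1.
  by rewrite sig'D // !in_setU (porbits_perm y (sF _ CF1)) (porbits_perm y (sF _ CF2)).
have pE : p \in E by apply: porbit_id.
have gE : trivial_cycle lab sig' E.
  (* Left translation by [g] preserves the increments of [h2] and matches it with [h1] at both
     junctions, [p] to [q] and [r] to [sig p]. *)
  pose g := h1 (sig p) * (h2 q)^-1.
  exists (fun x => if x \in C1 then h1 x else g * h2 x) => x /(subsetP subE).
  rewrite in_setU => xC.
  have [->|xp] := eqVneq x p.
    rewrite sig'p p1; case: ifP => [/dis-/(_ q2)//|_].
    by rewrite /g mulgVK -hP1.
  have [xr|xr] := eqVneq x r.
    rewrite xr sig'r (porbits_perm p (sF _ CF1)) p1; case: ifP => [/dis-/(_ r2)//|_].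
    by rewrite -mulgA -hP2 // sr /g mulgVK.
  rewrite sig'D // (porbits_perm x (sF _ CF1)).
  by case/orP: xC => xC; [rewrite xC hP1 | case: ifP => [/dis-/(_ xC)//|_]; rewrite hP2 // mulgA].
have E0 : E \notin F0 by rewrite inE pE andbF.
exists sig', (E |: F0); split=> //; split=> //.
  split; last by move=> D /setU1P[->|/g0].
  by apply/subsetP=> D /setU1P[->|/sF0//]; rewrite imset_f.
have : F \subset C1 |: (C2 |: F0).
  by apply/subsetP=> D /sub0/or3P[]; rewrite !inE => ->; rewrite ?orbT.
move=> /subset_leq_card; move: le rho; rewrite !cardsU1 E0.
by do 2!case: (_ \notin _); rewrite /=; clear; lia.
Qed.

(** Since [q] directly follows [p] in its cycle, only the value of [h] at [q] sees the two factors
    separately. *)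
Lemma diagram_relabel k lab p q s sig F j (x y x' y' : A j) :
  lab p = Tagged A x -> lab q = Tagged A y -> x * y = x' * y' ->
  sig p = q -> diagram k lab (p :: q :: s) sig F ->
  diagram k (update (update lab p (Tagged A x')) q (Tagged A y')) (p :: q :: s) sig F.
Proof.
move=> lp lq xy sp [U out tg [sF FP] le].
have pq : p != q by move: U; rewrite /= inE negb_or => /andP[/andP[]].
have sq : sig q != q by rewrite -{2}sp (inj_eq perm_inj) eq_sym.
have tgE z : tag (update (update lab p (Tagged A x')) q (Tagged A y') z) = tag (lab z).
  by rewrite /update; case: eqVneq => [->|_]; [rewrite lq | case: eqVneq => // ->; rewrite lp].
split=> //.
- move=> z; rewrite !inE !negb_or /update => /and3P[zp zq zs]; rewrite (negPf zp) (negPf zq).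
  by apply: out; rewrite !inE !negb_or zp zq.
- by move=> z; rewrite !tgE.
split=> // D DF; have [h hP] := FP _ DF; have DP := subsetP sF _ DF.
exists (fun z => if z == q then h p * iota j x' else h z) => z zD.
have xyG : iota j x * iota j y = iota j x' * iota j y' by rewrite -!gmulfM xy.
rewrite /update; have [zq|zq] := eqVneq z q.
  rewrite zq (negPf sq) hP -?zq // zq -{1}sp hP; last first.
    by rewrite -(porbits_perm p DP) sp -zq.
  by rewrite lp lq /ev /= -!mulgA xyG.
rewrite -{1}sp (inj_eq perm_inj); have [->|zp] := eqVneq z p; first by [].
by rewrite hP.
Qed.

(** Each of the two transpositions of [cyc_swap] loses at most one cycle of [rho], and one handle is
    worth two. *)
Lemma diagram_swap k lab a p b q c r sig F :
  diagram k lab (a :: p ++ b :: q ++ c :: r) sig F ->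
  diagram k.+1 lab (b :: q ++ a :: p ++ c :: r) sig F.
Proof.
case=> U out tg FP le; split=> //.
- by move: U; rewrite -!cat_cons !(uniq_catCA (b :: q)).
- by move=> x xs; apply: out; move: xs; rewrite -!cat_cons !mem_cat; do !case: (_ \in _).
rewrite cyc_swap // tperm_mulg.
set t := cyc _ in le *; set u := t * tperm a c.
have := card_porbits_tpermM (u * sig^-1) (u^-1 b) (u^-1 c).
have := card_porbits_mid t sig^-1 a c; rewrite -/u.
by move: le; rewrite -!cat_cons !size_cat; clear; lia.
Qed.
End OnFinite.

End Diagrams.

(** * Surfaces bounded by words *)

Section Surfaces.
Variables (J : Type) (A : J -> groupType) (G : groupType).
Variable iota : forall j : J, {multiplicative A j -> G}.
Variable j0 : J.
Local Notation letter := (letter A).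
Implicit Types (l : letter) (u v w c : seq letter).

Definition evw w : G := \prod_(l <- w) ev iota l.

Lemma evw_cat u v : evw (u ++ v) = evw u * evw v.
Proof. exact: big_cat. Qed.

(* Asking for diagrams on all large ['I_n] leaves room for inserting letters
   without changing the underlying set. *)
Definition surface k w := exists n0, forall n, (n0 <= n)%N ->
  exists lab s sig F,
    @diagram J A G iota j0 'I_n k lab s sig F /\ map lab s = w.

Lemma surface_rot k u v : surface k (u ++ v) -> surface k (v ++ u).
Proof.
case=> n0 H; exists n0 => n /H[lab [s [sig [F [dg E]]]]].
exists lab, (rot (size u) s), sig, F; split; first exact: diagram_rot.
by rewrite map_rot E rot_size_cat.
Qed.

Lemma surface_insert k j w : w <> [::] ->
  surface k w -> surface k (Tagged A (1 : A j) :: w).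
Proof.
move=> w0 [n0 H]; exists (n0 + (size w).+1)%N => n le.
have [|lab [s [sig [F [dg E]]]]] := H n; first by apply: leq_trans le; apply: leq_addr.
have [p ps] : exists p, p \notin s.
  apply/existsP; rewrite -negb_forall; apply/negP=> /forallP all_s.
  have : (#|'I_n| <= size s)%N.
    by apply: leq_trans (card_size s); apply/subset_leq_card/subsetP=> x _; apply: all_s.
  by rewrite card_ord -(size_map lab) E; move: le; clear; lia.
exists (update lab p (Tagged A (1 : A j))), (p :: s), sig, F; split.
  by apply: diagram_insert => //; apply/eqP => s0; case: w0; rewrite -E s0.
by rewrite /= map_update // {1}/update eqxx E.
Qed.

Lemma surface_delete k j w : w <> [::] ->
  surface k (Tagged A (1 : A j) :: w) -> surface k w.
Proof.
move=> w0 [n0 H]; exists n0 => n /H[lab [s [sig [F [dg E]]]]].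
case: s E dg => // p s [lp E] dg.
have lp1 : ev iota (lab p) = 1 by rewrite lp /ev /= iota1.
have [|sig' [F' [dg' sp]]] := diagram_isolate _ lp1 dg; first exact: mem_head.
have ps : p \notin s by case: dg => /= /andP[].
exists (update lab p (dummy A j0)), s, sig', F'; split.
  by apply: diagram_delete_fix dg' => //; apply/eqP => s0; case: w0; rewrite -E s0.
by rewrite map_update.
Qed.

Lemma surface_exchange k j (x y x' y' : A j) w : x * y = x' * y' ->
  surface k (Tagged A x :: Tagged A y :: w) ->
  surface k (Tagged A x' :: Tagged A y' :: w).
Proof.
move=> xy [n0 H]; exists n0 => n /H[lab [s [sig [F [dg E]]]]].
case: s E dg => // p [|q s] // [lp lq E] dg.
have [|sig' [F' [dg' sp]]] := diagram_adjacent _ dg; first by rewrite lp lq.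
have [pq ps qs] : [/\ p != q, p \notin s & q \notin s].
  by case: dg => /=; rewrite inE negb_or -andbA => /and4P[].
exists (update (update lab p (Tagged A x')) q (Tagged A y')), (p :: q :: s), sig', F'.
split; first exact: (diagram_relabel lp lq).
by rewrite /= !map_update // E /update !eqxx (negPf pq).
Qed.

Lemma surface_merge k j (x y : A j) w : w <> [::] ->
  surface k (Tagged A x :: Tagged A y :: w) <-> surface k (Tagged A (x * y) :: w).
Proof.
move=> w0; split=> H.
  apply: (@surface_rot _ w [:: _]); case: w w0 H => // l w _ H.
  apply: (@surface_delete _ j) => //.
  apply: (@surface_rot _ [:: Tagged A (x * y)] (Tagged A (1 : A j) :: l :: w)).
  by apply: surface_exchange H; rewrite mulg1.
apply: (@surface_exchange _ _ (x * y) 1); first by rewrite mulg1.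
apply: (@surface_rot _ (Tagged A (1 : A j) :: w) [:: Tagged A (x * y)]).
rewrite cat_cons; apply: surface_insert; first by case: w w0 H.
exact: (@surface_rot _ [:: _]).
Qed.

Lemma surfaceS k w : surface k w -> surface k.+1 w.
Proof.
case=> n0 H; exists n0 => n /H[lab [s [sig [F [dg E]]]]].
exists lab, s, sig, F; split=> //.
by case: dg => ? ? ? ? le; split=> //; move: le; clear; lia.
Qed.

Lemma surface_swap k u v w : w <> [::] ->
  surface k (u ++ v ++ w) -> surface k.+1 (v ++ u ++ w).
Proof.
case: u => [|a u]; first by move=> _ /surfaceS.
case: v => [|b v]; first by move=> _ /surfaceS.
case: w => [|c w] // _ [n0 H]; exists n0 => n /H[lab [s [sig [F [dg E]]]]].
have : exists (a' : 'I_n) p (b' : 'I_n) q (c' : 'I_n) r, [/\ s = a' :: p ++ b' :: q ++ c' :: r,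
    map lab (a' :: p) = a :: u, map lab (b' :: q) = b :: v & map lab (c' :: r) = c :: w].
  case: s E {dg} => // a' s [La E]; exists a', (take (size u) s).
  have Eu : map lab (take (size u) s) = u by rewrite map_take E take_size_cat.
  have := congr1 (drop (size u)) E; rewrite -map_drop drop_size_cat //.
  case D: (drop (size u) s) => [|b' s'] // [Lb E']; exists b', (take (size v) s').
  have Ev : map lab (take (size v) s') = v by rewrite map_take E' take_size_cat.
  have := congr1 (drop (size v)) E'; rewrite -map_drop drop_size_cat //.
  case D': (drop (size v) s') => [|c' r] // [Lc E'']; exists c', r.
  split; first by rewrite -D' cat_take_drop -D cat_take_drop.
  - by rewrite /= La Eu.
  - by rewrite /= Lb Ev.
  by rewrite /= Lc E''.
case=> a' [p [b' [q [c' [r [Es Ea Eb Ec]]]]]]; rewrite Es in dg.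
exists lab, (b' :: q ++ a' :: p ++ c' :: r), sig, F; split; first exact: diagram_swap.
by rewrite -!cat_cons !map_cat Ea Eb Ec.
Qed.

(** Here [sig] and [rho] are both the identity and every point is a disc for each, so the inequality
    is an equality. *)
Lemma surface_dummy : surface 0 [:: dummy A j0].
Proof.
exists 1%N => -[//|n] _; exists (fun=> dummy A j0), [:: ord0], 1, (porbits 1).
split=> //; split=> //; first by move=> x _; rewrite perm1.
  split=> // D _; exists (fun=> 1) => x _.
  by rewrite /ev /= iota1 mulg1.
have p1 : #|porbits (1 : {perm 'I_n.+1})| = #|'I_n.+1|.
  apply: card_imset => x y; rewrite porbit.unlock cycle1 !imset_set1 /aperm !perm1.
  exact: set1_inj.
have -> : cyc [:: ord0] * 1^-1 = 1 :> {perm 'I_n.+1}.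
  rewrite invg1 mulg1; apply/permP=> x; rewrite perm1.
  have [->|x0] := eqVneq x ord0; first by rewrite cycE //= /next /= eqxx.
  by rewrite cyc_out // inE.
by rewrite p1 card_ord /=; clear; lia.
Qed.

(* The moves need a nonempty remainder [c], as a diagram of the empty word would miss
   the boundary circle; this is why words are later prefixed by [dummy]. *)
Definition weq w w' := evw w = evw w' /\
  forall k c, c <> [::] -> (surface k (w ++ c) <-> surface k (w' ++ c)).

Lemma weq_refl w : weq w w.
Proof. by split. Qed.

Lemma weq_sym w w' : weq w w' -> weq w' w.
Proof. by case=> E H; split=> // k c c0; rewrite H. Qed.

Lemma weq_trans w1 w2 w3 : weq w1 w2 -> weq w2 w3 -> weq w1 w3.
Proof.
by case=> E1 H1 [E2 H2]; split=> [|k c c0]; [rewrite E1 | rewrite H1 // H2].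
Qed.

Lemma weq_cat u u' v v' : weq u u' -> weq v v' -> weq (u ++ v) (u' ++ v').
Proof.
case=> Eu Hu [Ev Hv]; split=> [|k c c0]; first by rewrite !evw_cat Eu Ev.
have nil x : x ++ c <> [::] by case: x.
rewrite -!catA Hu //.
have rotE x y : surface k (x ++ y) <-> surface k (y ++ x) by split; apply: surface_rot.
rewrite rotE -catA Hv; last by case: c {nil rotE} c0.
by rewrite rotE -!catA rotE -!catA rotE -!catA.
Qed.

Lemma weq_merge j (x y : A j) :
  weq [:: Tagged A x; Tagged A y] [:: Tagged A (x * y)].
Proof.
split=> [|k c c0]; last exact: surface_merge.
by rewrite /evw !big_cons big_nil !mulg1 /ev /= gmulfM.
Qed.

Lemma weq_one j : weq [:: Tagged A (1 : A j)] [::].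
Proof.
split=> [|k c c0]; first by rewrite /evw big_cons big_nil /ev /= iota1 mulg1.
by split; [apply: surface_delete | apply: surface_insert].
Qed.

Definition winv w : seq letter :=
  rev [seq Tagged A ((tagged l)^-1) | l <- w].

Lemma weq_inv w : weq (winv w ++ w) [::].
Proof.
elim: w => [|[j x] w IHw]; first exact: weq_refl.
rewrite /winv map_cons rev_cons -cats1 -/(winv w) -catA.
have H : weq ([:: Tagged A x^-1; Tagged A x]) [::].
  by apply: weq_trans (weq_merge _ _) _; rewrite mulVg; apply: weq_one.
apply: weq_trans IHw; apply: weq_cat (weq_refl _) _.
exact: (weq_cat H (weq_refl w)).
Qed.

Lemma winvK w : winv (winv w) = w.
Proof.
rewrite /winv map_rev revK -map_comp -[RHS]map_id.
by apply: eq_map => -[j x] /=; rewrite invgK.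
Qed.

(** The quotient of words by [weq], with a class encoded as its membership predicate. It is made a
    group receiving all the factors, so that the universal property of [G] applies to it. *)
Record wclass := WClass {
  wrel : seq letter -> Prop;
  wrelP : exists w, wrel = weq w }.

HB.instance Definition _ := gen_eqMixin wclass.
HB.instance Definition _ := gen_choiceMixin wclass.

Definition cls w : wclass := WClass (ex_intro (fun v => weq w = weq v) w erefl).

Definition word_of (a : wclass) : seq letter := projT1 (cid (wrelP a)).

Lemma wclass_eq a b : wrel a = wrel b -> a = b.
Proof.
case: a b => [a Pa] [b Pb] /= E; move: Pa Pb; rewrite E => Pa Pb.
by congr WClass; apply: Prop_irrelevance.
Qed.

Lemma word_ofK a : cls (word_of a) = a.
Proof. by apply: wclass_eq; rewrite /= -(projT2 (cid (wrelP a))). Qed.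

Lemma clsP u v : cls u = cls v <-> weq u v.
Proof.
split=> [/(congr1 wrel)/= E|uv]; first by rewrite E; apply: weq_refl.
apply: wclass_eq; apply/funext=> w /=; apply/propext.
by split; apply: weq_trans; [apply: weq_sym|].
Qed.

Lemma word_of_cls w : weq (word_of (cls w)) w.
Proof. by apply/clsP; rewrite word_ofK. Qed.

Definition wmul a b := cls (word_of a ++ word_of b).
Definition winvc a := cls (winv (word_of a)).

Lemma wmulE u v : wmul (cls u) (cls v) = cls (u ++ v).
Proof. by apply/clsP; apply: weq_cat; apply: word_of_cls. Qed.

Lemma wmulA : associative wmul.
Proof.
move=> a b c; rewrite -(word_ofK a) -(word_ofK b) -(word_ofK c) !wmulE.
by rewrite catA.
Qed.

Lemma wmul1 : left_id (cls [::]) wmul.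
Proof. by move=> a; rewrite -(word_ofK a) wmulE. Qed.

Lemma wmulr1 : right_id (cls [::]) wmul.
Proof. by move=> a; rewrite -(word_ofK a) wmulE cats0. Qed.

Lemma wmulV : left_inverse (cls [::]) winvc wmul.
Proof. by move=> a; rewrite -{2}(word_ofK a) wmulE; apply/clsP/weq_inv. Qed.

Lemma wmulrV : right_inverse (cls [::]) winvc wmul.
Proof.
move=> a; rewrite -{1}(word_ofK a) wmulE -{1}(winvK (word_of a)).
by apply/clsP/weq_inv.
Qed.

HB.instance Definition _ :=
  isGroup.Build wclass wmulA wmul1 wmulr1 wmulV wmulrV.

Definition letter_class j (x : A j) : wclass := cls [:: Tagged A x].

Lemma letter_classM j : {morph @letter_class j : x y / x * y}.
Proof. by move=> x y; rewrite [RHS]wmulE; apply/clsP/weq_sym/weq_merge. Qed.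

HB.instance Definition _ j :=
  isMultiplicative.Build (A j) wclass (@letter_class j) (@letter_classM j).

Definition eval_class (a : wclass) : G := evw (word_of a).

Lemma eval_cls w : eval_class (cls w) = evw w.
Proof. by case: (word_of_cls w). Qed.

Lemma eval_classM : {morph eval_class : a b / a * b}.
Proof. by move=> a b; rewrite eval_cls evw_cat. Qed.

HB.instance Definition _ :=
  isMultiplicative.Build wclass G eval_class eval_classM.

Hypothesis freeG : is_free_product iota.

(** The universal property gives [phi] from [G] to word classes with [phi (evw w) = cls w], so the
    value of a word determines its class. *)
Lemma evw_surj_weq :
  (forall g, exists w, evw w = g) /\ (forall u v, evw u = evw v -> weq u v).
Proof.
have [phi phiE _] := freeG (fun j => @letter_class j : {multiplicative A j -> wclass}).
have phiw w : phi (evw w) = cls w.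
  elim: w => [|[j x] w IHw].
    rewrite /evw big_nil; apply: (mulgI (phi 1)); rewrite -gmulfM mulg1.
    by rewrite [RHS]wmulr1.
  by rewrite /evw big_cons gmulfM -/(evw w) IHw [phi _]phiE [LHS]wmulE.
split=> [g|u v E]; last by apply/clsP; rewrite -!phiw E.
(* Evaluation after [phi] and the identity of [G] both extend [iota], hence agree by uniqueness; a
   word in the class [phi g] therefore has value [g]. *)
have [psi _ uni] := freeG iota.
exists (word_of (phi g)); rewrite -/(eval_class _).
have := uni (eval_class \o phi : {multiplicative G -> G}) _ g => /= ->; last first.
  by move=> j a; rewrite /= phiE eval_cls /evw big_cons big_nil mulg1.
by have := uni (idfun : {multiplicative G -> G}) _ g => /= <-.
Qed.

(* The step from [k] to [k + 1] exchanges [y] and [x] in [x^-1 y^-1 (y x) w]. *)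
Lemma surface_commutators (k : nat) (c : 'I_k -> G) w :
  (forall i, is_commutator (c i)) -> evw w = \prod_(i < k) c i ->
  surface k (dummy A j0 :: w).
Proof.
have [surj eqw] := evw_surj_weq.
have change k' u v : evw u = evw v -> surface k' (dummy A j0 :: u) -> surface k' (dummy A j0 :: v).
  move=> /eqw[_ /(_ k' [:: dummy A j0])H] Su.
  by apply: (@surface_rot _ v [:: _]); apply/H => //; apply: (@surface_rot _ [:: _]).
elim: k c w => [|k IHk] c w cC Ew.
  by apply: (change _ [::]); [rewrite Ew big_ord0 /evw big_nil | apply: surface_dummy].
have [x [y Exy]] := cC ord0; have [[X EX] [Y EY]] := (surj x, surj y).
have [W EW] := surj (\prod_(i < k) c (lift ord0 i)).
have evV u : evw (winv u) = (evw u)^-1.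
  apply: (mulIg (evw u)); rewrite mulVg -evw_cat.
  by case: (weq_inv u) => -> _; rewrite /evw big_nil.
have /surface_rot H : surface k ((dummy A j0 :: winv X ++ winv Y) ++ Y ++ X ++ W).
  rewrite cat_cons; apply: (change _ W); last by apply: IHk EW => i; apply: cC.
  by rewrite !evw_cat !evV -!mulgA mulKg mulKg.
apply: (change _ (winv X ++ winv Y ++ X ++ Y ++ W)).
  by rewrite Ew big_ord_recl Exy !evw_cat !evV EX EY EW commgEl conjgE !mulgA.
rewrite (catA (winv X)) -cat_cons; apply: (@surface_rot _ (X ++ Y ++ W)).
rewrite -!catA; apply: surface_swap; first by case: W {EW H}.
by rewrite -!catA in H.
Qed.

End Surfaces.

(** * Counting the discs of a periodic word *)

Section Ascents.
Variables (T : finType) (pi : {perm T}) (f : T -> nat) (D : {set T}).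
Hypothesis piD : D \in porbits pi.

(** Recording the level [f b] that the ascent crosses allows the extreme values to be located when
    the ascent is unique. *)
Lemma ascent_exists a b : a \in D -> b \in D -> (f a < f b)%N ->
  exists2 x, x \in D & (f x < f b <= f (pi x))%N.
Proof.
move=> aD bD ab; have Da := mem_porbits piD aD; rewrite Da in bD.
have [||x xD /andP[]] := @porbit_cross _ pi (fun x => f b <= f x)%N b a bD.
- by rewrite -ltnNge.
- exact: leqnn.
by rewrite -ltnNge => x1 x2; exists x; rewrite ?Da // x1.
Qed.

Lemma descent_exists a b : a \in D -> b \in D -> (f a < f b)%N ->
  exists2 x, x \in D & (f (pi x) < f x)%N.
Proof.
move=> aD bD ab; have Db := mem_porbits piD bD; rewrite Db in aD.
have [||x xD /andP[]] := @porbit_cross _ pi (fun x => f x < f b)%N a b aD.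
- by rewrite ltnn.
- exact: ab.
by rewrite -leqNgt => x1 x2; exists x; rewrite ?Db //; apply: leq_trans x2 x1.
Qed.

(* Think of the values of [f] as points of a circle of length [c].  If [f] has
   a single ascent on [D], the steps of [D] go once around the circle, and
   [balance] tells in which of two fixed half circles lies the midpoint of a step. *)
Definition balance c x :=
  if (f x < f (pi x))%N then (c <= f x + f (pi x))%N else (f x + f (pi x) < c)%N.

(** The only ascent runs from the minimum to the maximum. The step leaving the maximum has at least
    the same sum of end values, the step entering the minimum at most the same; one of them, not
    being an ascent, has the opposite balance. *)
Lemma balance_single_ascent c x0 : x0 \in D -> (f x0 < f (pi x0))%N ->
  {in D, forall x, (f x < f (pi x))%N -> x = x0} ->
  (exists2 x, x \in D & balance c x) /\ (exists2 x, x \in D & ~~ balance c x).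
Proof.
move=> x0D asc0 uniq0.
have px0D : pi x0 \in D by rewrite porbits_perm.
have fmax x : x \in D -> (f x <= f (pi x0))%N.
  move=> xD; rewrite leqNgt; apply/negP=> lt.
  have [y yD /andP[y1 y2]] := ascent_exists px0D xD lt.
  have y0 := uniq0 y yD (leq_trans y1 y2).
  by move: y2; rewrite y0 leqNgt lt.
have fmin x : x \in D -> (f x0 <= f x)%N.
  move=> xD; rewrite leqNgt; apply/negP=> lt.
  have [y yD /andP[y1 y2]] := ascent_exists xD x0D lt.
  have y0 := uniq0 y yD (leq_trans y1 y2).
  by move: y1; rewrite y0 ltnn.
have [le|lt] := leqP c (f x0 + f (pi x0)).
  split; first by exists x0 => //; rewrite /balance asc0.
  exists (pi x0) => //; rewrite /balance.
  have ppD : pi (pi x0) \in D by rewrite porbits_perm.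
  rewrite ltnNge fmax //= -leqNgt.
  by apply: leq_trans le _; rewrite addnC leq_add2l fmin.
split; last by exists x0 => //; rewrite /balance asc0 -ltnNge.
have zD : pi^-1 x0 \in D by rewrite -(porbits_perm _ piD) permKV.
exists (pi^-1 x0) => //; rewrite /balance permKV ltnNge fmin //=.
by apply: leq_ltn_trans lt; rewrite addnC leq_add2l fmax.
Qed.
End Ascents.

Lemma card_bool_sum (T : finType) (S : {set T}) (P : pred T) :
  #|[set x in S | P x]| = \sum_(x in S) (P x : nat).
Proof.
rewrite -sum1dep_card big_mkcondr; apply: eq_bigr => x _; by case: (P x).
Qed.

Lemma index_cyc (T : finType) (s : seq T) x : uniq s -> x \in s ->
  index (cyc s x) s = ((index x s).+1 %% size s)%N.
Proof.
move=> Us xs; rewrite cycE //; case: s Us xs => // a p Us xs.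
rewrite next_nth xs; have := xs; rewrite -index_mem.
move: (index x _) => i; rewrite [size _]/= ltnS leq_eqVlt => /orP[/eqP->|lt].
  by rewrite nth_default // modnn /= eqxx.
rewrite modn_small ?ltnS // -[nth a p i]/(nth a (a :: p) i.+1) index_uniq //.
Qed.

Lemma sum_index (T : finType) (s : seq T) (h : nat -> nat) : uniq s ->
  \sum_(x in [set y in s]) h (index x s) = \sum_(0 <= i < size s) h i.
Proof.
move=> Us; rewrite (eq_bigl (mem s)) => [|x]; last by rewrite inE.
rewrite -big_uniq //=; case: s Us => [|a p] U; first by rewrite !big_nil.
rewrite (big_nth a) !big_nat; apply: eq_bigr => i /andP[_ ip].
by rewrite index_uniq.
Qed.

Lemma sum_mod_neq0 n L : (0 < L)%N ->
  (\sum_(0 <= i < n * L) (i %% L != 0) = n * L.-1)%N.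
Proof.
move=> L0; elim: n => [|n IHn]; first by rewrite big_nil.
rewrite mulSn addnC (big_cat_nat (leq0n _) (leq_addr L _)) /= IHn mulSn addnC.
congr (_ + _)%N; rewrite -{1}[(n * L)%N]add0n big_addn addKn.
rewrite (eq_big_nat _ _ (F2 := fun i => nat_of_bool (i != 0))%N); last first.
  by move=> i /andP[_ iL]; rewrite addnC modnMDl modn_small.
case: L L0 {IHn} => // L _; rewrite big_nat_recl //= add0n.
by rewrite sum_nat_const_nat subn0 muln1.
Qed.

Section Counting.
Variables (T : finType) (s : seq T) (sig : {perm T}) (F : {set {set T}}).
Variables (n L N : nat).
Hypotheses (Us : uniq s) (sizes : size s = (n * L)%N) (L0 : (0 < L)%N) (N0 : (0 < N)%N).
Let r x := (index x s %% L)%N.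
Let rho : {perm T} := cyc s * sig^-1.
Hypothesis sig_out : forall x, x \notin s -> sig x = x.
Hypothesis rho_step : forall x, x \in s -> r (rho x) != r x.
Hypothesis sF : F \subset porbits sig.
Hypothesis constF : forall D, D \in F -> {in D, forall x, x \in s} ->
  {in D &, forall x y, r x = r y} -> (N <= #|D|)%N.

Let S := [set x in s].

Let sigS x : (sig x \in s) = (x \in s).
Proof.
have [xs|xs] := boolP (x \in s); last by rewrite sig_out // (negPf xs).
by apply: contraT => sxs; have E := perm_inj (sig_out sxs); rewrite E xs in sxs.
Qed.

Let cycS x : (cyc s x \in s) = (x \in s).
Proof. by rewrite cycE // mem_next. Qed.

Let r_cyc x : x \in s -> r (cyc s x) = ((r x).+1 %% L)%N.
Proof.
move=> xs; rewrite /r index_cyc // sizes modn_dvdm ?dvdn_mull //.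
by rewrite -[in RHS]addn1 modnDml addn1.
Qed.

Let r_lt x : (r x < L)%N. Proof. exact: ltn_pmod. Qed.

(** Indexing the steps of [rho] by their end point pairs the [rho]-step into [x] with the [sig]-step
    out of [x]. *)
Let sum_rho (b : T -> T -> nat) :
  \sum_(y in S) b y (rho y) = \sum_(x in S) b ((cyc s)^-1 (sig x)) x.
Proof.
rewrite (reindex_inj (perm_inj (s := sig * (cyc s)^-1))) /=.
apply: eq_big => [x|x _]; last by rewrite /rho !permM permKV permK.
by rewrite !inE permM -cycS permKV sigS.
Qed.

(** The local picture at a letter: [sig] goes from [i] to [j], [rho] comes from the cyclic
    predecessor [p] of [j]. The counts below are arithmetic in these three positions. *)
Let step x : x \in s ->
  let i := r x in let j := r (sig x) in let p := r ((cyc s)^-1 (sig x)) in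
  [/\ (i < L)%N, (p != i)%N & (j = p.+1 /\ p.+1 < L)%N \/ (j = 0 /\ p.+1 = L)%N].
Proof.
move=> xs /=; set y := (cyc s)^-1 (sig x).
have ys : y \in s by rewrite -cycS permKV sigS.
have := r_cyc ys; rewrite permKV => ->.
split; first exact: r_lt.
  by have := rho_step ys; rewrite /rho permM permKV permK eq_sym.
have := r_lt y; rewrite leq_eqVlt => /orP[/eqP E|lt]; [right|left].
  by rewrite {1}E modnn.
by rewrite modn_small.
Qed.

(* Letters sit at the even points of a circle of length [2 L], turns between
   consecutive letters at the odd ones. *)
Let fs x := (2 * r x)%N.
Let fr x := (2 * r x).+1.

Let As := [set x in S | fs x < fs (sig x)]%N.
Let Ar := [set x in S | fr x < fr (rho x)]%N.
Let Ds := [set x in S | fs (sig x) < fs x]%N.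
Let Dr := [set x in S | fr (rho x) < fr x]%N.
Let Ks := [set x in S | r (sig x) == r x].

Let cardS : #|S| = (n * L)%N.
Proof. by rewrite cardsE (card_uniqP Us). Qed.

Let card_asc : (#|As| + #|Ar| = n * L.-1)%N.
Proof.
rewrite /As /Ar !card_bool_sum (sum_rho (fun y z => (fr y < fr z)%N)) -big_split /=.
transitivity (\sum_(x in S) (r (sig x) != 0))%N.
  apply: eq_bigr => x; rewrite inE => /step[].
  by rewrite /fs /fr; move: (r _) (r _) (r _) => p i j; clear; lia.
rewrite -[RHS](sum_mod_neq0 n L0) -sizes.
transitivity (\sum_(x in S) (r x != 0))%N.
  rewrite [RHS](reindex_inj (perm_inj (s := sig))) /=.
  by apply: eq_bigl => x; rewrite !inE sigS.
exact: (sum_index (fun i => nat_of_bool (i %% L != 0)%N) Us).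
Qed.

Let card_desc : (#|As| + #|Ar| + #|Ds| + #|Dr| + #|Ks| = 2 * (n * L))%N.
Proof.
rewrite -cardS /As /Ar /Ds /Dr /Ks !card_bool_sum.
rewrite (sum_rho (fun y z => (fr y < fr z)%N)) (sum_rho (fun y z => (fr z < fr y)%N)).
rewrite -!big_split /= -sum1_card big_distrr /=.
apply: eq_bigr => x; rewrite inE => /step[].
by rewrite /fs /fr; move: (r _) (r _) (r _) => p i j; clear; lia.
Qed.

Let Bs := [set x in S | balance sig fs (2 * L) x].
Let Br := [set x in S | balance rho fr (2 * L) x].
Let Bs' := [set x in S | ~~ balance sig fs (2 * L) x].
Let Br' := [set x in S | ~~ balance rho fr (2 * L) x].

(** Exactly one of the two paired steps is balanced. If [j = p + 1], their end values have equal
    sums and just one is an ascent; if [j = 0], neither is, and the sums lie on opposite sides of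
    [2 L]. *)
Let card_balance : (#|Bs| + #|Br| = n * L)%N.
Proof.
rewrite -cardS /Bs /Br !card_bool_sum /balance.
rewrite (sum_rho (fun y z =>
  if (fr y < fr z)%N then (2 * L <= fr y + fr z)%N else (fr y + fr z < 2 * L)%N)).
rewrite -!big_split /= -sum1_card.
apply: eq_bigr => x; rewrite inE => /step[].
rewrite /fs /fr; move: (r _) (r _) (r _) => p i j; clear.
by case: ifP; case: ifP; lia.
Qed.

Let card_balanceC : (#|Bs'| + #|Br'| = n * L)%N.
Proof.
have H (P : pred T) : (#|[set x in S | P x]| + #|[set x in S | ~~ P x]| = n * L)%N.
  rewrite -cardS !card_bool_sum -big_split -sum1_card.
  by apply: eq_bigr => x _; case: (P x).
have := H (balance sig fs (2 * L)); have := H (balance rho fr (2 * L)).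
move: card_balance; rewrite /Bs /Br /Bs' /Br'; clear; lia.
Qed.

Let Fin := [set D in F | D \subset S].
Let Rin : {set {set T}} := [set D in porbits rho | D \subset S].
Let C := [set D in Fin | [forall x in D, forall y in D, r x == r y]].
Let NC := Fin :\: C.

(** Each cycle not contained in [S] uses up a point outside [S]. *)
Let card_outside (p : {perm T}) (E : {set {set T}}) : E \subset porbits p ->
  (#|E| <= #|[set D in E | D \subset S]| + (#|T| - n * L))%N.
Proof.
move=> sE; set E' := [set D in E | _].
rewrite -(cardsID E' E) leq_add ?subset_leq_card ?subsetIr //.
have -> : (#|T| - n * L = #|~: S|)%N by rewrite [RHS]cardsCs setCK cardS.
rewrite -sum1_card; apply: leq_trans (leq_sum_porbits (~: S) (subset_trans (subsetDl E E') sE)).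
apply: leq_sum => D; rewrite !inE => /andP[]; case: (D \in E) => //= nS _.
by rewrite card_gt0; apply: contra nS; rewrite setI_eq0 -subsets_disjoint.
Qed.

Let leq_card_family (p : {perm T}) (E : {set {set T}}) (B : {set T}) m :
  E \subset porbits p -> {in E, forall D, m <= #|D :&: B|}%N -> (#|E| * m <= #|B|)%N.
Proof.
move=> sE mE; apply: leq_trans (leq_sum_porbits B sE).
by rewrite -sum_nat_const; apply: leq_sum => D /mE.
Qed.

Let distinct_lt (D : {set T}) : ~~ [forall x in D, forall y in D, r x == r y] ->
  exists a b, [/\ a \in D, b \in D & (r a < r b)%N].
Proof.
case/forall_inPn=> a aD /forall_inPn[b bD ab].
have [lt|gt|E] := ltngtP (r a) (r b); first by exists a, b.
  by exists b, a.
by rewrite E eqxx in ab.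
Qed.

Let FinP D : D \in Fin -> [/\ D \in F, D \in porbits sig & D \subset S].
Proof. by rewrite inE => /andP[DF DS]; split=> //; apply: (subsetP sF). Qed.

Let NCP D : D \in NC -> [/\ D \in porbits sig, D \subset S &
  exists a b, [/\ a \in D, b \in D & (fs a < fs b)%N]].
Proof.
rewrite inE [D \in C]inE => /andP[nC DF]; have [_ sD DS] := FinP DF; split=> //.
rewrite DF in nC; have [a [b [aD bD ab]]] := distinct_lt nC.
by exists a, b; rewrite /fs ltn_pmul2l.
Qed.

Let RinP D : D \in Rin -> [/\ D \in porbits rho, D \subset S &
  exists a b, [/\ a \in D, b \in D & (fr a < fr b)%N]].
Proof.
rewrite inE => /andP[rD DS]; split=> //.
have [x xD] : exists x, x \in D by case/imsetP: rD => x _ ->; exists x; apply: porbit_id.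
have pxD : rho x \in D by rewrite porbits_perm.
have xs : x \in s by have := subsetP DS _ xD; rewrite inE.
have [lt|gt|E] := ltngtP (r x) (r (rho x)); last by have := rho_step xs; rewrite E eqxx.
  by exists x, (rho x); split=> //; rewrite /fr ltnS ltn_pmul2l.
by exists (rho x), x; split=> //; rewrite /fr ltnS ltn_pmul2l.
Qed.

Let sNC : NC \subset porbits sig.
Proof. by apply/subsetP=> D /NCP[]. Qed.

Let sRin : Rin \subset porbits rho.
Proof. by apply/subsetP=> D /RinP[]. Qed.

Let CP D : D \in C -> [/\ D \in porbits sig, D \subset S, (N <= #|D|)%N &
  {in D &, forall x y, r x = r y}].
Proof.
rewrite inE => /andP[/FinP[DF sD DS] /forall_inP H].
have cD : {in D &, forall x y, r x = r y}.
  by move=> x y /H/forall_inP H' /H'/eqP.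
by split=> //; apply: constF => // x /(subsetP DS); rewrite inE.
Qed.

Let sC : C \subset porbits sig.
Proof. by apply/subsetP=> D /CP[]. Qed.

Let meets (D : {set T}) (P : pred T) : D \subset S -> (exists2 x, x \in D & P x) ->
  (1 <= #|D :&: [set x in S | P x]|)%N.
Proof.
move=> /subsetP DS [x xD Px]; rewrite card_gt0; apply/set0Pn; exists x.
by rewrite inE xD inE DS.
Qed.

Let NC_As : {in NC, forall D, 1 <= #|D :&: As|}%N.
Proof.
move=> D /NCP[sD DS [a [b [aD bD ab]]]]; apply: meets => //.
have [x xD /andP[x1 x2]] := ascent_exists sD aD bD ab.
by exists x => //; apply: leq_trans x1 x2.
Qed.

Let Rin_Ar : {in Rin, forall D, 1 <= #|D :&: Ar|}%N.
Proof.
move=> D /RinP[sD DS [a [b [aD bD ab]]]]; apply: meets => //.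
have [x xD /andP[x1 x2]] := ascent_exists sD aD bD ab.
by exists x => //; apply: leq_trans x1 x2.
Qed.

Let X := (#|NC| + #|Rin|)%N.

Let le_asc : (X <= n * L.-1)%N.
Proof.
rewrite -card_asc leq_add //.
  by have := leq_card_family sNC NC_As; rewrite muln1.
by have := leq_card_family sRin Rin_Ar; rewrite muln1.
Qed.

(** Of the [2 n L] steps, [n (L - 1)] are ascents. Among the others, each nonconstant cycle has a
    descent and each constant disc at least [N] stationary steps. *)
Let le_desc : (X + #|C| * N <= n * L.+1)%N.
Proof.
have HD : (#|NC| <= #|Ds|)%N.
  rewrite -[#|NC|]muln1; apply: (leq_card_family sNC) => D /NCP[sD DS [a [b [aD bD ab]]]].
  exact/meets/(descent_exists sD aD bD ab).
have HR : (#|Rin| <= #|Dr|)%N.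
  rewrite -[#|Rin|]muln1; apply: (leq_card_family sRin) => D /RinP[sD DS [a [b [aD bD ab]]]].
  exact/meets/(descent_exists sD aD bD ab).
have HK : (#|C| * N <= #|Ks|)%N.
  apply: (leq_card_family sC) => D /CP[sD /subsetP DS ND cD].
  rewrite (_ : D :&: Ks = D) //; apply/setP=> x; rewrite inE andbC inE.
  case: (boolP (x \in D)) => xD; last by rewrite andbF.
  by rewrite DS //= (cD (sig x) x) ?eqxx ?porbits_perm.
move: card_asc card_desc HD HR HK L0; rewrite /X; clear; case: L => // l; nia.
Qed.

(* Equality in [le_asc] forces a single ascent on every cycle. *)
Let single_ascent (p : {perm T}) (f : T -> nat) (E : {set {set T}}) :
  E \subset porbits p ->
  {in E, forall D, 1 <= #|D :&: [set x in S | f x < f (p x)]|}%N ->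
  (forall D, D \in E -> D \subset S) ->
  #|E| = #|[set x in S | f x < f (p x)]| ->
  {in E, forall D : {set T}, (exists2 x, x \in D & balance p f (2 * L) x) /\
                   (exists2 x, x \in D & ~~ balance p f (2 * L) x)}.
Proof.
move=> sE HE SE eqE D DE; set As' := [set x in S | _] in HE eqE.
have H1 : #|D :&: As'| = 1%N.
  apply/eqP; rewrite eqn_leq HE // andbT.
  have := leq_sum_porbits As' sE; rewrite -eqE -[#|E|]sum1_card !(bigD1 D DE) /=.
  set a := (\sum_(i in E | i != D) _)%N; set b := (\sum_(i in E | i != D) _)%N.
  have : (b <= a)%N by apply: leq_sum => i /andP[iE _]; apply: HE.
  by move: a b #|_| => a b c; clear; lia.
have /eqP/cards1P[x0 Ex0] := H1.
have : x0 \in D :&: As' by rewrite Ex0 inE.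
rewrite inE => /andP[x0D]; rewrite inE => /andP[_ asc0].
apply: (@balance_single_ascent _ _ _ _ (subsetP sE _ DE) _ x0) => // x xD ascx.
by apply/set1P; rewrite -Ex0 inE xD inE ascx (subsetP (SE _ DE)).
Qed.

Let le_half : X = (n * L.-1)%N -> (#|C| <= 2 * (n %/ N))%N.
Proof.
move=> eqX.
have HNC := leq_card_family sNC NC_As; have HR := leq_card_family sRin Rin_Ar.
rewrite muln1 in HNC; rewrite muln1 in HR.
have [E1 E2] : #|NC| = #|As| /\ #|Rin| = #|Ar|.
  move: eqX card_asc HNC HR; rewrite /X.
  by move: #|NC| #|Rin| #|As| #|Ar| (n * _)%N => a b c d e; clear; lia.
have B1 := single_ascent sNC NC_As (fun D DE => let: And3 _ h _ := NCP DE in h) E1.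
have B2 := single_ascent sRin Rin_Ar (fun D DE => let: And3 _ h _ := RinP DE in h) E2.
(* The Boolean [b] selects a half circle: a stationary [sig]-step at position [r] is balanced
   exactly when [2 r < L]. *)
have half (b : bool) : (#|[set D in C | [forall x in D, (2 * r x < L) == b]]| <= n %/ N)%N.
  rewrite leq_divRL //; set C' := [set D in C | _].
  pose B := [set x in S | balance sig fs (2 * L) x == b].
  pose B' := [set x in S | balance rho fr (2 * L) x == b].
  have cB : (#|B| + #|B'| = n * L)%N.
    rewrite /B /B'; case: (b) => /=.
      rewrite -card_balance; congr (_ + _)%N; apply: eq_card => x; by rewrite !inE eqb_id.
    rewrite -card_balanceC; congr (_ + _)%N; apply: eq_card => x; by rewrite !inE eqbF_neg.
  have HB' : (#|Rin| <= #|B'|)%N.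
    rewrite -[#|Rin|]muln1; apply: (leq_card_family sRin) => D DR.
    have [[x xD Hx] [y yD Hy]] := B2 D DR; have [_ DS _] := RinP DR; apply: meets => //.
    by case: (b); [exists x | exists y] => //; rewrite ?Hx // eqbF_neg.
  have HB : (#|NC| + #|C'| * N <= #|B|)%N.
    rewrite -[#|NC|]muln1 -!sum_nat_const.
    have dis : [disjoint NC & C'].
      apply/pred0P=> D; apply/negP=> /andP[/setDP[_ nC] /setIdP[DC _]].
      by rewrite DC in nC.
    have sU : NC :|: C' \subset porbits sig.
      rewrite subUset sNC; apply/subsetP=> D; rewrite inE => /andP[/CP[]] //.
    apply: leq_trans (leq_sum_porbits B sU); 
    rewrite [leqRHS](eq_bigl (mem [predU NC & C'])) => [|D]; last by rewrite in_setU.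
    rewrite bigU //.
    apply: leq_add; apply: leq_sum => D.
      move=> DN; have [[x xD Hx] [y yD Hy]] := B1 D DN; have [_ DS _] := NCP DN; apply: meets => //.
      by case: (b); [exists x | exists y] => //; rewrite ?Hx // eqbF_neg.
    rewrite inE => /andP[/CP[sD /subsetP DS ND cD] /forall_inP Hb].
    rewrite (_ : D :&: B = D) //; apply/setP=> x; rewrite inE andbC inE.
    case: (boolP (x \in D)) => xD; last by rewrite andbF.
    have sxD : sig x \in D by rewrite porbits_perm.
    rewrite DS //= -(eqP (Hb _ xD)) /balance /fs (cD _ _ sxD xD) ltnn.
    by rewrite -mulnDr addnn -mul2n ltn_pmul2l ?eqxx.
  (* Of the [n L] steps with balance [b], the nonconstant cycles take [n (L - 1)], leaving at most
     [n] for the discs of [C']. *)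
  move: eqX cB HB' HB L0; rewrite /X; move: (#|C'| * N)%N; clear; case: L => // l; nia.
have := leq_add (half true) (half false); rewrite mul2n -addnn; apply: leq_trans.
set Ct := [set D in C | _]; set Cf := [set D in C | _].
apply: leq_trans (leq_card_setU Ct Cf).
apply/subset_leq_card/subsetP=> D DC; have [sD _ _ cD] := CP DC.
have [x xD] : exists x, x \in D by case/imsetP: sD => x _ ->; exists x; apply: porbit_id.
apply/setUP; case Hx: (2 * r x < L)%N; [left|right]; apply/setIdP; split=> //;
  by apply/forall_inP=> y yD; rewrite (cD y x yD xD) Hx.
Qed.

Lemma card_cycles_bound :
  (#|F| + #|porbits rho| + 2 * (n * L) <= 2 * #|T| + n * L.-1 + 2 * (n %/ N))%N.
Proof.
have hF := card_outside sF; have hR := card_outside (subxx (porbits rho)).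
have hT : (n * L <= #|T|)%N by rewrite -cardS max_card.
have hC : #|Fin| = (#|C| + #|NC|)%N.
  rewrite -(cardsID C Fin) (setIidPr _) //; by apply/subsetP=> D; rewrite inE => /andP[].
suff : (X + #|C| <= n * L.-1 + 2 * (n %/ N))%N.
  move: hF hR hT; rewrite -/Fin -/Rin hC /X.
  move: #|F| #|porbits rho| #|NC| #|C| #|Rin| #|T| (n * L)%N (n * L.-1)%N (n %/ N)%N.
  by clear; lia.
have := le_asc; rewrite leq_eqVlt => /orP[/eqP E|lt].
  by rewrite E leq_add2l le_half.
(* Let [X = n (L - 1) - d] with [d >= 1]. With [2 q + d + 1] or more constant discs, [le_desc] would
   give [(d + 1) N <= 2 m + d], contradicting [m <= N - 1]. *)
move: lt le_desc (divn_eq n N) (ltn_pmod n N0) L0 N0.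
move: X (n %/ N)%N (n %% N)%N #|C| => x q m c; clear.
case: L => // l; case: N => // N' lt le E ltm _ _.
rewrite leqNgt; apply/negP; nia.
Qed.
End Counting.

(** * Cyclic reduction and the theorem *)

Section CyclicReduction.
Variables (J : Type) (A : J -> groupType) (G : groupType).
Variable iota : forall j : J, {multiplicative A j -> G}.
Variable j0 : J.
Local Notation letter := (letter A).
Local Notation dummy := (dummy A j0).
Implicit Types (v w : seq letter).

Definition wpow n w := flatten (nseq n w).

Lemma evw_wpow n w : evw iota (wpow n w) = evw iota w ^+ n.
Proof.
elim: n => [|n IHn]; first by rewrite /evw big_nil.
by rewrite /wpow /= evw_cat -/(wpow n w) IHn expgS.
Qed.

Lemma size_wpow n w : size (wpow n w) = (n * size w)%N.
Proof. by elim: n => //= n IHn; rewrite /wpow /= size_cat -/(wpow n w) IHn mulSn. Qed.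

Lemma nth_wpow d n w i : (i < n * size w)%N ->
  nth d (wpow n w) i = nth d w (i %% size w).
Proof.
elim: n i => //= n IHn i; rewrite mulSn => lt.
rewrite /wpow /= nth_cat -/(wpow n w); case: ltnP => le; first by rewrite modn_small.
rewrite IHn; last by move: lt le; clear; lia.
by rewrite -[in RHS](subnK le) modnDr.
Qed.

Lemma evw_rot i w : evw iota (rot i w) = evw iota w ^ evw iota (take i w).
Proof.
by rewrite -[in X in _ = X ^ _](cat_take_drop i w) /rot !evw_cat conjgE !mulgA mulVg mul1g.
Qed.

Lemma nth_rot01 d w i : (1 < size w)%N -> (i < size w)%N ->
  nth d (rot i w) 0 = nth d w i /\ nth d (rot i w) 1 = nth d w (i.+1 %% size w).
Proof.
move=> w1 iw; rewrite /rot !nth_cat !size_drop !nth_drop addn0 addn1.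
rewrite subn_gt0 iw; split=> //; case: ltnP => le.
  by rewrite modn_small //; move: le; clear; lia.
have -> : i.+1 = size w by move: le iw; clear; lia.
rewrite modnn (_ : 1 - _ = 0)%N; last by move: iw; clear; lia.
by rewrite nth_take //; move: w1 le; clear; lia.
Qed.

Hypothesis freeG : is_free_product iota.

(** Take a shortest word for a conjugate of [u]. Rotation brings any place to the front, where a
    trivial letter could be dropped and two letters of one factor merged. *)
Lemma cyclic_reduction (u : G) :
  (forall j (a : A j), ~ conjugate_to u (iota j a)) ->
  exists g w, [/\ evw iota w = u ^ g, (1 < size w)%N
    & forall i, (i < size w)%N -> ev iota (nth dummy w i) != 1 /\
        tag (nth dummy w i) <> tag (nth dummy w (i.+1 %% size w))].
Proof.
move=> u_nconj.
pose P m := exists g w, evw iota w = u ^ g /\ size w = m.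
have [surj _] := evw_surj_weq j0 freeG.
have exP : exists m, `[< P m >].
  have [w Ew] := surj u; exists (size w); apply/asboolP; exists 1, w.
  by rewrite conjg1.
case: (ex_minnP exP) => m /asboolP[g [w [Ew sw]]] min_m; rewrite -{}sw in min_m.
have {}min_m g' v : evw iota v = u ^ g' -> (size w <= size v)%N.
  by move=> E; apply: min_m; apply/asboolP; exists g', v.
have w1 : (1 < size w)%N.
  have back x : u ^ g = x -> u = x ^ g^-1 by move=> <-; rewrite conjgK.
  case: (w) Ew => [|[j x] [|//]]; rewrite /evw ?big_cons big_nil ?mulg1 => /esym/back E.
    by case: (u_nconj j0 1); exists g^-1; rewrite iota1.
  by case: (u_nconj j x); exists g^-1.
exists g, w; split=> // i iw.
have [E0 E1] := nth_rot01 dummy w1 iw; rewrite -E0 -E1.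
have Er : evw iota (rot i w) = u ^ (g * evw iota (take i w)).
  by rewrite evw_rot Ew conjgM.
have := size_rot i w; case: (rot i w) Er => [|[j x] [|[j' x'] v]] Er /= sv;
  [by rewrite -sv in w1 | by rewrite -sv in w1 |]; split.
  apply/eqP=> x1; move: Er; rewrite /evw big_cons x1 mul1g => /min_m /=.
  by rewrite -sv ltnn.
move=> Ej; move: x' Er; rewrite -Ej => x' Er.
have /min_m /= : evw iota (Tagged A (x * x') :: v) = u ^ (g * evw iota (take i w)).
  by rewrite -Er /evw !big_cons mulgA; congr (_ * _); rewrite /ev /= gmulfM.
by rewrite -sv ltnn.
Qed.

End CyclicReduction.

Lemma has_order_leq (G : groupType) (x : G) m : (0 < m)%N -> x ^+ m = 1 ->
  exists2 d, has_order x d & (d <= m)%N.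
Proof.
move=> m0 xm; have exm : exists d, (0 < d)%N && (x ^+ d == 1).
  by exists m; rewrite m0 xm eqxx.
case: (ex_minnP exm) => d /andP[d0 /eqP xd] min_d; exists d; last first.
  by apply: min_d; rewrite m0 xm eqxx.
split=> // e /andP[e0 ed] xe; have := min_d e; rewrite e0 xe eqxx leqNgt ed.
by move=> /(_ isT).
Qed.

(** Going once around the cycle multiplies [h] by [g] to the power [#|D|] and returns to the
    start. *)
Lemma trivial_cycle_const J (A : J -> groupType) (G : groupType)
    (iota : forall j : J, {multiplicative A j -> G}) (T : finType)
    (lab : T -> letter A) (sig : {perm T}) (D : {set T}) (g : G) :
  D \in porbits sig -> trivial_cycle iota lab sig D ->
  {in D, forall x, ev iota (lab x) = g} -> g ^+ #|D| = 1.
Proof.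
move=> /imsetP[x _ ->] [h hP] cg.
have hX i : h ((sig ^+ i) x) = h x * g ^+ i.
  elim: i => [|i IHi]; first by rewrite perm1 mulg1.
  by rewrite expgSr permM hP ?mem_porbit // IHi cg ?mem_porbit // -mulgA -expgSr.
apply: (mulgI (h x)); rewrite -hX mulg1 permX.
by rewrite iter_porbit.
Qed.

Theorem corollary1
  (J : Type) (inhJ : inhabited J) (A : J -> groupType)
  (G : groupType) (iota : forall j : J, {multiplicative A j -> G})
  (freeG : is_free_product iota)
  (N : option nat) (N_pos : ext_pos N) (ordG : no_order_below G N)
  (k n : nat) (n_ge1 : (1 <= n)%N)
  (c : 'I_k -> G) (c_comm : forall i : 'I_k, is_commutator (c i))
  (u : G) (u_nconj : forall (j : J) (a : A j), ~ conjugate_to u (iota j a))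
  (eq_cu : (\prod_(i < k) c i = u ^+ n)%g) :
  (n%:Z - 2 * (floor_quot n N)%:Z + 1 <= 2 * k%:Z)%R
  /\ ((n %/ 2)%:Z - (floor_quot n N)%:Z + 1 <= k%:Z)%R.
Proof.
case: inhJ => j0.
(* For infinite [N] the value [n + 1] makes the quotient 0; any lower bound on constant discs then
   holds, as no nonidentity element has finite order. *)
pose M := if N is Some N0 then N0 else n.+1.
have M0 : (0 < M)%N by rewrite /M; case: (N) N_pos.
have -> : floor_quot n N = (n %/ M)%N by rewrite /M; case: (N) => //=; rewrite divn_small.
suff : (n + 1 <= 2 * (n %/ M) + 2 * k)%N by clear; lia.
have [g [w [Ew w1 w_red]]] := cyclic_reduction j0 freeG u_nconj.
set L := size w in w1 w_red.
have S : surface iota j0 k (dummy A j0 :: wpow n w).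
  apply: (@surface_commutators _ _ _ _ _ freeG _ (fun i => c i ^ g)).
    by move=> i; have [x [y ->]] := c_comm i; exists (x ^ g), (y ^ g); rewrite conjRg.
  by rewrite -conjg_prod eq_cu evw_wpow Ew conjXg.
have [|n0 {}S] := surface_delete _ S.
  by move/(congr1 size)/eqP; rewrite size_wpow /= muln_eq0 !gtn_eqF // ltnW.
have [lab [s [sig [F [[Us out tg [sF FP] le] Es]]]]] := S n0 (leqnn n0).
have ss : size s = (n * L)%N by rewrite -(size_map lab) Es size_wpow.
have L0 : (0 < L)%N := ltnW w1.
have lab_nth x : x \in s -> lab x = nth (dummy A j0) w (index x s %% L).
  move=> xs; rewrite -(@nth_wpow _ _ _ n); last by rewrite -/L -ss index_mem.
  by rewrite -Es (nth_map x) ?index_mem ?nth_index.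
have := @card_cycles_bound _ s sig F n L M Us ss L0 M0 (fun x xs => (out x xs).1).
set rho := cyc s * sig^-1 => /(_ _ sF) bound.
have {bound} : (#|F| + #|porbits rho| + 2 * (n * L) <= 2 * #|'I_n0| + n * L.-1 + 2 * (n %/ M))%N.
  apply: bound => [x xs|D DF Ds cD].
    have cs : cyc s x \in s by rewrite cycE // mem_next.
    have ys : rho x \in s.
      by apply: contraT => ys; have [E _] := out _ ys; rewrite -E permM permKV cs in ys.
    (* As [sig] preserves factors and maps [rho x] to the letter after [x], equal positions of [x]
       and [rho x] would put two consecutive letters of [w] in one factor. *)
    apply/eqP=> E; have [_] := w_red _ (ltn_pmod (index x s) L0); apply.
    rewrite -{1}E -lab_nth // -tg permM permKV lab_nth // index_cyc // ss.
    by rewrite modn_dvdm ?dvdn_mull // -[in RHS]addn1 modnDml addn1.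
  have /imsetP[x _ Dx] := subsetP sF _ DF.
  have xD : x \in D by rewrite Dx porbit_id.
  have [gn _] := w_red _ (ltn_pmod (index x s) L0); rewrite -lab_nth ?Ds // in gn.
  (* All labels on a constant disc are the same nontrivial element, whose order is thus at most the
     length of the disc. *)
  have gD : ev iota (lab x) ^+ #|D| = 1.
    apply: (trivial_cycle_const (subsetP sF _ DF) (FP _ DF)) => y yD.
    by rewrite !lab_nth ?Ds // (cD y x).
  have D0 : (0 < #|D|)%N by rewrite card_gt0; apply/set0Pn; exists x.
  have [d dO dD] := has_order_leq D0 gD.
  apply: leq_trans dD; have := ordG _ _ (elimN eqP gn) dO; rewrite /M.
  by case: (N) => [N0|] //=; rewrite -leqNgt.
(* The Euler characteristic inequality bounds the number of discs from below, [card_cycles_bound]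
   from above; their difference is the claim. *)
move: le; rewrite ss -/rho card_ord; move: #|F| #|porbits rho| (n %/ M)%N => a b q.
case: L L0 {w1 w_red ss lab_nth} => // l _; clear; nia.
Qed.
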